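(* Let $\nu$ be any probability on $\mathbb N$ and let $(b_n)_{n\in\mathbb N}$ be a sequence of positive numbers diverging to $+\infty$. (i) If $b_n\gg n^{1/\alpha}$, then $M_n/b_n\to0$ in $\mathbb P_\nu$-probability as $n\to\infty$. (ii) If $b_n\ll n^{1/\alpha}$, then for every $r>0$, $$\limsup_{n\to\infty}\ \mathbb P_\nu\big(|M_n/b_n|>r\big)=1 .$$
   Context: $\mathbb N=\{0,1,2,\dots\}$. For positive sequences, $a_n\ll b_n$ (equivalently $b_n\gg a_n$) means $\lim_{n\to\infty}a_n/b_n=0$. Fix $\Lambda>1$ and $p_\uparrow,p_\downarrow>0$ with $p_\uparrow+p_\downarrow=1$ and $1<p_\downarrow/p_\uparrow<\Lambda^2$, and set $$\alpha:=\frac{\log(p_\downarrow/p_\uparrow)}{\log\Lambda}\in(0,2).$$ Let $L=(L_n)_{n\in\mathbb N}$ be the Markov chain on $\mathbb N$ that from $0$ jumps to $1$ with probability $1$, and from $j>0$ jumps to $j+1$ with probability $p_\uparrow$ and to $j-1$ with probability $p_\downarrow$. Let $(\xi_k)_{k\in\mathbb N}$ be i.i.d. standard Gaussian real random variables, independent of $L$. For a probability $\nu$ on $\mathbb N$, $\mathbb P_\nu$ denotes the joint law of $(\xi,L)$ when $L_0\sim\nu$. Set $$M_n:=\sum_{k=0}^{n-1}\Lambda^{L_k}\xi_k .$$ *)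

(* Defs.v *)
From mathcomp Require Export all_boot all_order all_algebra.
From mathcomp Require Export all_classical all_reals all_analysis.
Export Order.TTheory GRing.Theory Num.Theory numFieldNormedType.Exports.

Set Implicit Arguments.
Unset Strict Implicit.
Unset Printing Implicit Defensive.

Local Open Scope classical_set_scope.
Local Open Scope ring_scope.

Section Asymptotics.
Context {R : realType}.

Definition much_less (a b : R^nat) : Prop := a n / b n @[n --> \oo] --> (0 : R).

End Asymptotics.

Section Independence.
Context {d : measure_display} {T : measurableType d} {R : realType}.
Variable P : probability T R.

Definition sigma_rvs {d' : measure_display} {T' : measurableType d'}
    (X : nat -> {RV P >-> T'}) : set (set T) :=
  <<s \bigcup_k preimage_set_system setT (X k) measurable >>.

Definition independent_seq {d' : measure_display} {T' : measurableType d'}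
    (X : nat -> {RV P >-> T'}) : Prop :=
  forall (J : seq nat) (B : nat -> set T'), uniq J ->
    (forall k, measurable (B k)) ->
    P (\big[setI/setT]_(k <- J) (X k @^-1` B k)) =
    (\prod_(k <- J) P (X k @^-1` B k))%E.

Definition independent_sigma (F G : set (set T)) : Prop :=
  forall A B, F A -> G B -> P (A `&` B) = (P A * P B)%E.

Definition has_law {d' : measure_display} {T' : measurableType d'}
    (X : {RV P >-> T'}) (mu : set T' -> \bar R) : Prop :=
  forall B : set T', measurable B -> distribution P X B = mu B.

(* Conditional probabilities are multiplied out, so that histories of
   probability zero impose no condition. *)
Definition markov_chain (nu : probability nat R) (p : nat -> nat -> R)
    (X : nat -> {RV P >-> nat}) : Prop :=
  has_law (X 0%N) nu /\
  forall (n : nat) (x : nat -> nat) (j : nat),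
    P [set w | (forall k, (k <= n)%N -> X k w = x k) /\ X n.+1 w = j] =
    (P [set w | forall k, (k <= n)%N -> X k w = x k] * (p (x n) j)%:E)%E.

Definition cvg_in_probability (X : nat -> T -> R) (Y : T -> R) : Prop :=
  forall e : R, 0 < e ->
    P [set w | e < `|X n w - Y w|] @[n --> \oo] --> 0%E.

End Independence.

Section Model.
Context {R : realType}.

Definition walk_step (pup pdown : R) (i j : nat) : R :=
  if i is i'.+1 then pup *+ (j == i.+1) + pdown *+ (j == i')
  else (j == 1%N)%:R.

Definition critical_exponent (Lambda pup pdown : R) : R :=
  ln (pdown / pup) / ln Lambda.

Definition weighted_sum {T : Type} (Lambda : R) (L : nat -> T -> nat)
    (xi : nat -> T -> R) (n : nat) (w : T) : R :=
  \sum_(0 <= k < n) Lambda ^+ L k w * xi k w.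

End Model.

(* Main.v *)
From HB Require Import structures.
Require Import Defs.
From mathcomp Require Import measurable_realfun ring lra.

(** Write rho for pdown / pup. Given the path of the walk, M_n is a centred
Gaussian variable of variance V_n, the sum of Lambda ^ (2 L_k) over k < n. Since
rho < Lambda ^ 2, the size of V_n is governed by the largest value reached by
the walk before time n, which is about log n / log rho because the stationary
weight of the state j is of order rho ^- j. As Lambda = rho ^ (1 / alpha), this
means that M_n is of order n ^ (1 / alpha). In the second part the probability
even converges to 1.

Upper bound. The stationary weights form an invariant measure, so on the event
L_0 <= K the law of each L_k is at most rho ^ K times this measure
([walk_marginal_le]). Hence, with probability close to 1, L_0 <= K and the walk
stays below a height h as soon as rho ^ h is a large multiple of n
([walk_tail_le]); on that event the expectation of V_n is at most a constant
times n (Lambda ^ 2 / rho) ^ h, which is of order n ^ (2 / alpha), and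
Chebyshev's inequality given the path concludes ([weighted_sum_tail],
[weighted_sum_negligible]).

Lower bound. If H is the function with H(0) = 0 whose increment g(x) is the
expected time needed to climb from x to x + 1, then H(L_n) - n is a martingale
up to the hitting time of h, so the walk stays below h during n steps with
probability at most H(h) / n, whatever the initial law ([walk_stays_below_le]);
and H(h) is at most a constant times rho ^ h. When the walk has reached h, one
of the coefficients of the Gaussian variables is at least Lambda ^ h, and
conditioning on all the other variables bounds the probability that |M_n| <= x
by a constant times x / Lambda ^ h ([lincomb_small_ball],
[weighted_sum_small_ball], [weighted_sum_diverges]).

The two facts needed about a linear combination of independent standard
Gaussian variables, a second moment bound and the small ball bound, follow by
peeling off one variable at a time with Tonelli's theorem; its law is never
computed. Conditioning on the path is a summation over the countably many
values of the history of the walk ([conditional_bound_integral]). *)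

Set Implicit Arguments.
Unset Strict Implicit.
Unset Printing Implicit Defensive.

Local Open Scope classical_set_scope.
Local Open Scope ring_scope.

(** * The standard normal law *)

Section Density.
Import HBNNSimple.
Local Open Scope ereal_scope.
Context d (T : measurableType d) (R : realType).
Variables (mu nu : {measure set T -> \bar R}) (g : T -> R).
Hypotheses (mg : measurable_fun setT g) (g0 : forall x, (0 <= g x)%R).
Hypothesis nuE :
  forall A, measurable A -> nu A = \int[mu]_(x in A) (g x)%:E.

Lemma ge0_integral_density (f : T -> \bar R) :
  measurable_fun setT f -> (forall x, 0 <= f x) ->
  \int[nu]_x f x = \int[mu]_x (f x * (g x)%:E).
Proof.
move=> mf f0; pose h := nnsfun_approx measurableT mf.
have mge : measurable_fun setT (EFin \o g) by exact/measurable_EFinP.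
have hE n : \int[nu]_x (h n x)%:E = \int[mu]_x ((h n x)%:E * (g x)%:E).
  under eq_integral do rewrite fimfunE -fsumEFin//.
  under [RHS]eq_integral => x _.
    rewrite fimfunE -fsumEFin// ge0_mule_fsuml; last first.
      by move=> r; rewrite EFinM nnfun_muleindic_ge0.
    over.
  rewrite ge0_integral_fsum//; last 2 first.
  - by move=> r; exact/measurable_EFinP/measurableT_comp.
  - by move=> n' x _; rewrite EFinM nnfun_muleindic_ge0.
  rewrite ge0_integral_fsum//; last 2 first.
  - move=> r; apply: emeasurable_funM => //.
    exact/measurable_EFinP/measurableT_comp.
  - move=> n' x _; rewrite mule_ge0//; last by rewrite lee_fin.
    by rewrite EFinM nnfun_muleindic_ge0.
  apply: eq_fsbigr => r /[!inE] -[y _ hy].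
  have r0 : (0 <= r)%R by rewrite -hy.
  under [RHS]eq_integral do rewrite EFinM -muleA.
  rewrite ge0_integralZl//; last 2 first.
  - by apply: emeasurable_funM => //; exact/measurable_EFinP/measurable_indic.
  - by move=> x _; rewrite mule_ge0// lee_fin.
  under eq_integral do rewrite EFinM.
  rewrite ge0_integralZl//; last first.
    exact/measurable_EFinP/measurable_indic.
  rewrite integral_indic// setIT nuE// [in LHS]integral_mkcond.
  congr (_ * _); apply: eq_integral => x _.
  by rewrite patchE indicE; case: ifPn => _; rewrite ?mul1e ?mul0e.
have fE (m : {measure set T -> \bar R}) (k : T -> R) :
    measurable_fun setT k -> (forall x, (0 <= k x)%R) ->
    \int[m]_x (f x * (k x)%:E) =
    limn (fun n => \int[m]_x ((h n x)%:E * (k x)%:E)).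
  move=> mk k0; rewrite -monotone_convergence//.
  - apply: eq_integral => x _; apply/esym/cvg_lim => //.
    by apply: cvgeZr => //; exact: cvg_nnsfun_approx.
  - move=> n; apply: emeasurable_funM; apply/measurable_EFinP => //.
  - by move=> n x _; rewrite mule_ge0// lee_fin.
  - move=> x _ a b ab; rewrite lee_wpmul2r ?lee_fin//.
    exact/lefP/nd_nnsfun_approx.
transitivity (\int[nu]_x (f x * (cst 1%R x)%:E)).
  by apply: eq_integral => x _; rewrite mule1.
rewrite !fE//; apply: congr_lim; apply/funext => n.
by rewrite -hE; apply: eq_integral => x _; rewrite mule1.
Qed.

End Density.

Section Gaussian.
Context {R : realType}.
Local Notation gam := (normal_prob (0:R) 1).

Lemma normal_pdf_std (x : R) :
  normal_pdf 0 1 x = normal_peak 1 * expR (- x ^+ 2 / 2).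
Proof.
by rewrite normal_pdfE ?oner_neq0// /normal_fun subr0 expr1n mulr2n.
Qed.

Lemma ge0_integral_lebesgueN (f : R -> \bar R) :
  measurable_fun setT f -> (forall x, 0 <= f x)%E ->
  (\int[lebesgue_measure]_x f (- x)%R = \int[lebesgue_measure]_x f x)%E.
Proof.
move=> mf f0.
rewrite -(preimage_setT (-%R : _ -> measurableTypeR R)).
rewrite -ge0_integral_pushforward//=.
by apply: eq_measure_integral => A mA _; exact: lebesgue_measureN.
Qed.

Lemma ge0_integral_normal_prob (f : R -> \bar R) :
  measurable_fun setT f -> (forall x, 0 <= f x)%E ->
  (\int[gam]_x f x = \int[lebesgue_measure]_x (f x * (normal_pdf 0 1 x)%:E))%E.
Proof.
move=> mf f0; apply: ge0_integral_density => //.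
- exact: measurable_normal_pdf.
- exact: normal_pdf_ge0.
Qed.

Lemma ge0_integral_normal_probN (f : R -> \bar R) :
  measurable_fun setT f -> (forall x, 0 <= f x)%E ->
  (\int[gam]_x f (- x)%R = \int[gam]_x f x)%E.
Proof.
move=> mf f0; rewrite !ge0_integral_normal_prob//; last first.
  exact: measurableT_comp.
rewrite -[RHS]ge0_integral_lebesgueN.
- apply: eq_integral => x _; congr (_ * _%:E)%E.
  by rewrite !normal_pdf_std sqrrN.
- apply: emeasurable_funM => //; apply/measurable_EFinP.
  exact: measurable_normal_pdf.
- by move=> x; rewrite mule_ge0// lee_fin normal_pdf_ge0.
Qed.

(** The exact value 1 of the second moment is not needed: x ^ 2 is at most
4 exp (x ^ 2 / 4), which compares the integral with the total mass of a normal
density of variance 2. *)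
Lemma normal_second_moment_bounded :
  exists2 C : R, 0 <= C & (\int[gam]_x (x ^+ 2)%:E <= C%:E)%E.
Proof.
pose s : R := Num.sqrt 2.
have s0 : s != 0 by rewrite gt_eqF// sqrtr_gt0.
have p0 := normal_peak_gt0 s0.
pose C : R := 4 * normal_peak 1 / normal_peak s.
have C0 : 0 <= C by rewrite divr_ge0 ?mulr_ge0 ?normal_peak_ge0.
exists C => //.
rewrite ge0_integral_normal_prob; last 2 first.
- by apply/measurable_EFinP; exact: measurable_funX.
- by move=> x; rewrite lee_fin sqr_ge0.
rewrite -[leRHS]mule1 -(integral_normal_pdf (0:R) s).
rewrite -ge0_integralZl//; last 2 first.
- by apply/measurable_EFinP; exact: measurable_normal_pdf.
- by move=> x _; rewrite lee_fin normal_pdf_ge0.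
apply: ge0_le_integral => //.
- by move=> x _; rewrite -EFinM lee_fin mulr_ge0 ?sqr_ge0 ?normal_pdf_ge0.
- apply/measurable_EFinP; apply: measurable_funM.
    exact: measurable_funX.
  exact: measurable_normal_pdf.
- apply/measurable_EFinP; apply: measurable_funM => //.
  exact: measurable_normal_pdf.
move=> x _; rewrite -!EFinM lee_fin normal_pdf_std normal_pdfE//.
rewrite /normal_fun subr0 sqr_sqrtr// /C.
have -> : 4 * normal_peak 1 / normal_peak s *
    (normal_peak s * expR (- x ^+ 2 / (2 *+ 2))) =
    normal_peak 1 * (4 * expR (- x ^+ 2 / (2 *+ 2))) :> R.
  by field; rewrite gt_eqF.
rewrite mulrCA ler_wpM2l ?normal_peak_ge0//.
have -> : expR (- x ^+ 2 / (2 *+ 2)) =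
    expR (x ^+ 2 / 4) * expR (- x ^+ 2 / 2) :> R.
  by rewrite -expRD; congr expR; field.
rewrite mulrA ler_wpM2r ?expR_ge0//.
have := expR_ge1Dx (x ^+ 2 / 4); lra.
Qed.

(** The cross term vanishes because the law is symmetric: averaging the
integrals for a and - a only involves nonnegative integrands. *)
Lemma normal_affine_second_moment (C : R) :
  (\int[gam]_x (x ^+ 2)%:E <= C%:E)%E ->
  forall a z : R,
  (\int[gam]_x ((a * x + z) ^+ 2)%:E <= (C * a ^+ 2 + z ^+ 2)%:E)%E.
Proof.
move=> hC a z.
have ms (c : R) : measurable_fun setT (fun x : R => ((c * x + z) ^+ 2)%:E).
  apply/measurable_EFinP/measurable_funX; exact: measurable_funD.
set I := (\int[gam]_x ((a * x + z) ^+ 2)%:E)%E.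
have I0 : (0 <= I)%E by apply: integral_ge0 => x _; rewrite lee_fin sqr_ge0.
have IN : I = (\int[gam]_x ((- a * x + z) ^+ 2)%:E)%E.
  rewrite /I -ge0_integral_normal_probN//; last first.
    by move=> x; rewrite lee_fin sqr_ge0.
  by apply: eq_integral => x _; rewrite mulrN mulNr.
have : (I + I <= (2 * (C * a ^+ 2 + z ^+ 2))%:E)%E.
  rewrite {2}IN /I -ge0_integralD//; last 4 first.
  - by move=> x _; rewrite lee_fin sqr_ge0.
  - exact: ms.
  - by move=> x _; rewrite lee_fin sqr_ge0.
  - exact: ms.
  have key (x : R) : (a * x + z) ^+ 2 + (- a * x + z) ^+ 2 =
      2 * a ^+ 2 * x ^+ 2 + 2 * z ^+ 2 by ring.
  under eq_integral do rewrite -EFinD key EFinD EFinM.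
  have m2 : measurable_fun setT (fun x : R => (x ^+ 2)%:E).
    by apply/measurable_EFinP; exact: measurable_funX.
  have c0 (c : R) : 0 <= 2 * c ^+ 2 by rewrite mulr_ge0 ?sqr_ge0.
  rewrite ge0_integralD//; last 3 first.
  - by move=> x _; rewrite -EFinM lee_fin mulr_ge0 ?sqr_ge0.
  - exact: emeasurable_funM.
  - by move=> x _; rewrite lee_fin.
  rewrite ge0_integralZl//; last 2 first.
  - by move=> x _; rewrite lee_fin sqr_ge0.
  - by rewrite lee_fin.
  have icst (c : R) : (\int[gam]_x c%:E = c%:E)%E.
    by rewrite integral_cst// [X in (_ * X)%E]probability_setT mule1.
  rewrite icst mulrDr EFinD leeD2r//.
  rewrite (_ : 2 * (C * a ^+ 2) = 2 * a ^+ 2 * C)%R; last by ring.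
  by rewrite [leRHS]EFinM lee_wpmul2l// lee_fin mulr_ge0 ?sqr_ge0.
case: I I0 {IN} => [r| |] //.
by rewrite -EFinD !lee_fin => _; lra.
Qed.

(** The bound does not depend on the centre y. *)
Lemma normal_prob_small_ball (a y x : R) : 0 < a -> 0 <= x ->
  (gam [set u : R | (`|a * u + y| <= x)%R] <=
   (normal_peak 1 * (2 * x / a))%:E)%E.
Proof.
move=> a0 x0.
have -> : [set u : R | `|a * u + y| <= x] = `[(- x - y) / a, (x - y) / a]%classic.
  apply/seteqP; split => u /=; rewrite in_itv/= ler_pdivrMr// ler_pdivlMr//.
    by rewrite ler_norml => /andP[h1 h2]; apply/andP; split; lra.
  by move=> /andP[h1 h2]; rewrite ler_norml; apply/andP; split; lra.
rewrite /normal_prob.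
apply: (@le_trans _ _ (\int[lebesgue_measure]_(u in
    `[((- x - y) / a)%R, ((x - y) / a)%R]) (normal_peak 1)%:E)%E).
  apply: ge0_le_integral => //.
  - by move=> u _; rewrite lee_fin normal_pdf_ge0.
  - apply/measurable_EFinP; apply: measurable_funTS.
    exact: measurable_normal_pdf.
  - by move=> u _; rewrite lee_fin normal_pdf_ub// oner_neq0.
rewrite integral_cst// [X in (_ * X)%E]lebesgue_measure_itv/= lte_fin.
case: ifPn => _.
  rewrite -EFinD -EFinM lee_fin ler_wpM2l ?normal_peak_ge0//.
  rewrite le_eqVlt; apply/orP; left; apply/eqP.
  by field; rewrite gt_eqF.
rewrite mule0 lee_fin mulr_ge0 ?normal_peak_ge0// divr_ge0 ?(ltW a0)//.
by rewrite mulr_ge0.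
Qed.

End Gaussian.

(** * Independence and linear combinations *)

Section JointLaw.
Local Open Scope ereal_scope.
Context d d1 d2 (T : measurableType d) (T1 : measurableType d1)
  (T2 : measurableType d2) (R : realType) (P : probability T R).
Variables (U : {RV P >-> T1}) (V : {RV P >-> T2}).
Hypothesis UV : forall A B, measurable A -> measurable B ->
  P (U @^-1` A `&` V @^-1` B) = P (U @^-1` A) * P (V @^-1` B).

Let pairUV : T -> T1 * T2 := fun w => (U w, V w).

Let measurable_pairUV : measurable_fun setT pairUV.
Proof. exact: measurable_fun_pair. Qed.

(** Two independent variables have the product of their laws as joint law. *)
Lemma joint_law D : measurable D ->
  P (pairUV @^-1` D) = (distribution P U \x distribution P V) D.
Proof.
move=> mD; apply/esym.
pose W : {RV P >-> (T1 * T2)%type} := HB.pack pairUV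
  (isMeasurableFun.Build _ _ _ _ _ measurable_pairUV).
exact: (product_measure_unique (m' := distribution P W)).
Qed.

(** If E is independent of each rectangle event for the pair (U, V), then it is
independent of every event of the pair: the law of the pair conditioned on E is
determined by its values on rectangles. *)
Lemma joint_law_indep E : measurable E ->
  (forall A B, measurable A -> measurable B ->
    P (U @^-1` A `&` V @^-1` B `&` E) =
    P (U @^-1` A) * P (V @^-1` B) * P E) ->
  forall D, measurable D -> P (pairUV @^-1` D `&` E) = P (pairUV @^-1` D) * P E.
Proof.
move=> mE UVE D mD.
pose W : {RV P >-> (T1 * T2)%type} := HB.pack pairUV
  (isMeasurableFun.Build _ _ _ _ _ measurable_pairUV).
have mW : measurable (pairUV @^-1` D) by exact: (measurable_funPTI W).
have [PE0|PE0] := eqVneq (P E) 0.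
  rewrite PE0 mule0; apply/eqP; rewrite eq_le measure_ge0 andbT -PE0.
  by apply: le_measure => //; rewrite ?inE//; exact: measurableI.
have [e PEE] : exists e : R, P E = e%:E.
  by exists (fine (P E)); rewrite fineK// fin_num_measure.
have e0 : (0 < e)%R.
  by rewrite -lte_fin -PEE lt_neqAle eq_sym PE0 measure_ge0.
have p1 : (0 <= e^-1)%R by rewrite invr_ge0 ltW.
(* m' is the law of (U, V) under P conditioned on E. *)
pose m' : {measure set (T1 * T2) -> \bar R} :=
  mscale (NngNum p1) (pushforward (mrestr P mE) W).
have mWE : measurable_fun setT W by [].
rewrite joint_law// (product_measure_unique (m' := m' mWE))//.
  rewrite /m' /mscale/= /pushforward /mrestr PEE muleC muleA -EFinM.
  by rewrite divff ?gt_eqF// mul1e.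
move=> A B mA mB; rewrite /m' /mscale/= /pushforward /mrestr.
rewrite [X in _ * X = _](_ : _ = P (U @^-1` A `&` V @^-1` B `&` E))//.
by rewrite UVE// PEE [LHS]muleC -muleA -EFinM divff ?gt_eqF// mule1.
Qed.

End JointLaw.

Section LinearCombination.
Context d (T : measurableType d) (R : realType) (P : probability T R).
Variables (X : nat -> {RV P >-> R}).
Hypothesis Xindep : independent_seq X.

(** The combination of the variables X k, for k in the list s, with coefficients
a k. *)
Definition lincomb (a : nat -> R) (s : seq nat) (w : T) : R :=
  \sum_(k <- s) a k * X k w.

Lemma measurable_lincomb a s : measurable_fun setT (lincomb a s).
Proof.
by apply: measurable_sum => k; exact: measurable_funM.
Qed.

HB.instance Definition _ a s :=
  isMeasurableFun.Build _ _ _ _ (lincomb a s) (measurable_lincomb a s).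

Let rect (C : nat -> set R) (t : seq nat) : set T :=
  \big[setI/setT]_(k <- t) (X k @^-1` C k).

Let measurable_rect C t : (forall k, measurable (C k)) -> measurable (rect C t).
Proof.
move=> mC; rewrite /rect; elim/big_ind : _ => //.
  by move=> A B; exact: measurableI.
by move=> k _; exact: measurable_funPTI.
Qed.

(** A combination of some of the variables is independent of the rectangle events
of the other ones. The induction on s moves the first variable of s to the other
side, whence the generality in t. *)
Lemma lincomb_indep (a : nat -> R) s t C B : uniq (s ++ t) ->
  measurable B -> (forall k, measurable (C k)) ->
  P (lincomb a s @^-1` B `&` rect C t) =
  (P (lincomb a s @^-1` B) * P (rect C t))%E.
Proof.
elim: s t C B => [|k s IH] t C B.
  move=> _ mB mC; rewrite /lincomb.
  have -> : (fun w : T => \sum_(k <- [::]) a k * X k w) = cst 0 :> (T -> R).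
    by apply/funext => w; rewrite big_nil.
  rewrite preimage_cst; case: ifPn => _.
    by rewrite setTI probability_setT mul1e.
  by rewrite set0I measure0 mul0e.
rewrite cat_cons cons_uniq => /andP[knst ust] mB mC.
have knt : k \notin t.
  by apply: contra knst => kt; rewrite mem_cat kt orbT.
have ut : uniq t by move: ust; rewrite cat_uniq => /and3P[].
have us1 : uniq (s ++ [:: k]).
  move: knst ust; rewrite mem_cat negb_or cats1 rcons_uniq cat_uniq.
  by case/andP => -> _ /and3P[->].
have uskt : uniq (s ++ k :: t).
  by rewrite -cat1s uniq_catCA/= knst.
pose C' A := fun i => if i == k then A else C i.
have mC' A : measurable A -> forall i, measurable (C' A i).
  by move=> mA i; rewrite /C'; case: ifPn.
have rC' A : rect (C' A) (k :: t) = X k @^-1` A `&` rect C t.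
  rewrite /rect big_cons {1}/C' eqxx; congr (_ `&` _).
  apply: eq_big_seq => i it; rewrite /C'; case: eqP => // ik.
  by move: knt; rewrite -ik it.
pose U := X k; pose V : {RV P >-> R} := lincomb a s.
have UVt A B' : measurable A -> measurable B' ->
    P (U @^-1` A `&` V @^-1` B' `&` rect C t) =
    (P (U @^-1` A) * P (V @^-1` B') * P (rect C t))%E.
  move=> mA mB'.
  rewrite [_ `&` V @^-1` _]setIC -setIA -rC' IH//; last exact: mC'.
  rewrite [in LHS]/rect Xindep//; [|by rewrite /= knt|exact: mC'].
  rewrite big_cons {1}/C' eqxx muleA [X in (X * _)%E]muleC; congr (_ * _)%E.
  rewrite /rect Xindep//; apply: eq_big_seq => i it; rewrite /C'.
  case: eqP => // ik.
  by move: knt; rewrite -ik it.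
have UV A B' : measurable A -> measurable B' ->
    P (U @^-1` A `&` V @^-1` B') = (P (U @^-1` A) * P (V @^-1` B'))%E.
  move=> mA mB'; have := @IH [:: k] (fun=> A) B' us1 mB' (fun=> mA).
  by rewrite /rect !big_cons !big_nil !setIT setIC muleC.
pose D : set (R * R) := (fun p => a k * p.1 + p.2) @^-1` B.
have mD : measurable D.
  rewrite -[D]setTI.
  apply: (_ : measurable_fun setT (fun p : R * R => a k * p.1 + p.2)) => //.
  by apply: measurable_funD => //; apply: measurable_funM.
have -> : lincomb a (k :: s) @^-1` B = (fun w => (U w, V w)) @^-1` D.
  by apply/seteqP; split=> w; rewrite /D/= /lincomb big_cons.
by apply: joint_law_indep => //; exact: measurable_rect.
Qed.

(** Peeling off one variable: X k is independent of a combination of others. *)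
Lemma lincomb_joint_law a k s D : uniq (k :: s) -> measurable D ->
  P ((fun w => (lincomb a s w, X k w)) @^-1` D) =
  (distribution P (lincomb a s : {RV P >-> R}) \x distribution P (X k))%E D.
Proof.
move=> /= /andP[ks us].
apply: (@joint_law _ _ _ _ _ _ _ P (lincomb a s : {RV P >-> R})) => A B mA mB.
have us1 : uniq (s ++ [:: k]) by rewrite cats1 rcons_uniq ks.
have := @lincomb_indep a s [:: k] (fun=> B) A us1 mA (fun=> mB).
by rewrite /rect !big_cons !big_nil !setIT.
Qed.

End LinearCombination.

(** * Linear combinations of independent standard normal variables *)

Lemma ge0_integral_distribution_normal d (T : measurableType d)
    (R : realType) (P : probability T R) (X : {RV P >-> R}) (f : R -> \bar R) :
  has_law X (normal_prob 0 1) ->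
  measurable_fun setT f -> (forall x, 0 <= f x)%E ->
  (\int[distribution P X]_x f x = \int[normal_prob (0:R) 1]_x f x)%E.
Proof.
move=> Xlaw mf f0.
have mid : measurable_fun setT (idfun : measurableTypeR R -> R).
  exact: measurable_id.
transitivity (\int[pushforward (normal_prob (0:R) 1)
    (idfun : measurableTypeR R -> R)]_x f x)%E.
  by apply: eq_measure_integral => A mA _; exact: Xlaw.
by rewrite ge0_integral_pushforward.
Qed.

Section GaussianCombination.
Context d (T : measurableType d) (R : realType) (P : probability T R).
Variables (X : nat -> {RV P >-> R}).
Hypothesis Xindep : independent_seq X.
Hypothesis Xlaw : forall k, has_law (X k) (normal_prob 0 1).
Local Notation comb := (lincomb X).

(** C is any bound on the second moment of the standard normal law. *)
Lemma lincomb_second_moment (C : R) (a : nat -> R) (s : seq nat) : 0 <= C ->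
  (\int[normal_prob (0:R) 1]_x (x ^+ 2)%:E <= C%:E)%E -> uniq s ->
  (\int[P]_w ((comb a s w) ^+ 2)%:E <= (C * \sum_(k <- s) a k ^+ 2)%:E)%E.
Proof.
move=> C0 hC; elim: s => [|k s IH] us.
  rewrite big_nil mulr0 [leLHS](_ : _ = 0%E)//; apply: integral0_eq => w _.
  by rewrite /lincomb big_nil expr0n.
pose Z : {RV P >-> R} := comb a s.
pose f (p : R * R) := ((a k * p.2 + p.1) ^+ 2)%:E.
have mf : measurable_fun setT f.
  apply/measurable_EFinP/measurable_funX/measurable_funD => //.
  exact: measurable_funM.
have f0 p : (0 <= f p)%E by rewrite lee_fin sqr_ge0.
pose W w := (Z w, X k w).
have mW : measurable_fun setT W by exact: measurable_fun_pair.
have -> : (\int[P]_w ((comb a (k :: s) w) ^+ 2)%:E =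
    \int[P]_w (f \o W) w)%E.
  by apply: eq_integral => w _; rewrite /f /= /lincomb big_cons.
rewrite -(preimage_setT W) -ge0_integral_pushforward//.
rewrite (eq_measure_integral (distribution P Z \x distribution P (X k))%E);
    last first.
  by move=> A mA _; exact: lincomb_joint_law.
rewrite fubini_tonelli1//.
apply: (@le_trans _ _
    (\int[distribution P Z]_z (C * a k ^+ 2 + z ^+ 2)%:E)%E).
  apply: ge0_le_integral => //.
  - by move=> z _; apply: integral_ge0.
  - by apply: measurable_fun_fubini_tonelli_F.
  - apply/measurable_EFinP/measurable_funD => //; exact: measurable_funX.
  move=> z _; rewrite /fubini_F/=.
  rewrite [leLHS](_ : _ = \int[normal_prob (0:R) 1]_x f (z, x))%E.
    exact: normal_affine_second_moment.
  apply: ge0_integral_distribution_normal => //.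
  by apply: measurableT_comp => //; exact: measurable_fun_pair.
have Ca0 : 0 <= C * a k ^+ 2 by rewrite mulr_ge0 ?sqr_ge0.
rewrite ge0_integral_distribution//; last 2 first.
- apply/measurable_EFinP/measurable_funD => //; exact: measurable_funX.
- by move=> z; rewrite lee_fin addr_ge0 ?sqr_ge0.
under eq_integral do rewrite /= EFinD.
rewrite ge0_integralD//; last 2 first.
- by move=> w _; rewrite lee_fin sqr_ge0.
- by apply/measurable_EFinP/measurable_funX.
rewrite integral_cst// [X in (_ * X + _)%E]probability_setT mule1.
rewrite big_cons mulrDr [leRHS]EFinD.
by rewrite leeD2l// IH//; case/andP: us.
Qed.

Lemma lincomb_tail (C : R) (a : nat -> R) (s : seq nat) (x : R) : 0 <= C ->
  (\int[normal_prob (0:R) 1]_x (x ^+ 2)%:E <= C%:E)%E -> uniq s -> 0 < x ->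
  (P [set w | (x < `|comb a s w|)%R] <=
   (C * (\sum_(k <- s) a k ^+ 2) / x ^+ 2)%:E)%E.
Proof.
move=> C0 hC us x0.
have x20 : 0 < x ^+ 2 by rewrite exprn_gt0.
pose Z : {RV P >-> R} := comb a s.
have := @markov _ _ _ P Z (fun r => r ^+ 2) x x0.
move=> /(_ (measurable_funX _ (@measurable_id _ _ _)) (fun r _ => sqr_ge0 r)).
have hom : {in Num.nneg &, {homo (fun r : R => r ^+ 2) : x y / x <= y}}.
  by move=> u v; rewrite !nnegrE => u0 v0 uv; rewrite ler_pXn2r.
move=> /(_ hom) mk.
have {}mk : ((x ^+ 2)%:E * P [set w | (x <= `|Z w|)%R] <=
    (C * \sum_(k <- s) a k ^+ 2)%:E)%E.
  apply: (le_trans mk); rewrite unlock.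
  under eq_integral do rewrite /= real_normK ?num_real//.
  exact: lincomb_second_moment.
have le1 : (P [set w | (x < `|comb a s w|)%R] <=
    P [set w | (x <= `|Z w|)%R])%E.
  have mabs : measurable_fun setT (fun w => `|Z w|) by exact: measurableT_comp.
  apply: le_measure; rewrite ?inE.
  - rewrite (_ : [set _ | _] = (fun w => `|Z w|) @^-1` `]x, +oo[%classic).
      by rewrite -[X in measurable X]setTI; exact: mabs.
    by apply/seteqP; split => w/=; rewrite in_itv/= andbT.
  - rewrite (_ : [set _ | _] = (fun w => `|Z w|) @^-1` `[x, +oo[%classic).
      by rewrite -[X in measurable X]setTI; exact: mabs.
    by apply/seteqP; split => w/=; rewrite in_itv/= andbT.
  - by move=> w /= /ltW.
apply: (le_trans le1); rewrite mulrC EFinM lee_pdivlMl//.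
Qed.

(** Any positive coefficient can be used: given the other variables, the
variable X k alone already spreads the sum. *)
Lemma lincomb_small_ball (a : nat -> R) (s : seq nat) (k : nat) (x : R) :
  uniq s -> k \in s -> 0 < a k -> 0 <= x ->
  (P [set w | (`|comb a s w| <= x)%R] <=
   (normal_peak 1 * (2 * x / a k))%:E)%E.
Proof.
move=> us ks ak x0.
pose Z : {RV P >-> R} := comb a (rem k s).
pose D : set (R * R) := [set p | `|a k * p.2 + p.1| <= x].
have mD : measurable D.
  have mh : measurable_fun setT (fun p : R * R => `|a k * p.2 + p.1|).
    apply: measurableT_comp => //; apply: measurable_funD => //.
    exact: measurable_funM.
  rewrite (_ : D = (fun p : R * R => `|a k * p.2 + p.1|) @^-1` `]-oo, x]%classic).
    by rewrite -[X in measurable X]setTI; exact: mh.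
  by apply/seteqP; split => w/=; rewrite in_itv/=.
have -> : [set w | (`|comb a s w| <= x)%R] =
    (fun w => (comb a (rem k s) w, X k w)) @^-1` D.
  by apply/seteqP; split => w; rewrite /D/= /lincomb (big_rem k ks).
rewrite lincomb_joint_law//; last by rewrite /= mem_rem_uniqF// rem_uniq.
rewrite /product_measure1.
apply: (@le_trans _ _ (\int[distribution P Z]_z
   (normal_peak 1 * (2 * x / a k))%:E)%E).
  apply: ge0_le_integral => //.
  - exact: measurable_fun_xsection.
  move=> z _ /=; rewrite Xlaw; last exact: measurable_xsection.
  rewrite (_ : xsection D z = [set u : R | (`|a k * u + z| <= x)%R]).
    exact: normal_prob_small_ball.
  by apply/seteqP; split => u; rewrite /xsection/= inE.
by rewrite integral_cst// [X in (_ * X)%E]probability_setT mule1.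
Qed.

End GaussianCombination.

(** * Conditioning on a variable with countably many values *)

Section CountableConditioning.
Local Open Scope ereal_scope.
Context d (T : measurableType d) (R : realType) (P : {measure set T -> \bar R}).
Context (C : countType) (H : T -> C).
Hypothesis mH : forall l, measurable [set w | H w = l].

Lemma measurable_countable_preimage (S : set C) : measurable [set w | S (H w)].
Proof.
rewrite (_ : [set w | S (H w)] = \bigcup_(l in S) [set w | H w = l]).
  rewrite bigcup_mkcond; apply: countable_bigcupT_measurable => // l.
  by case: ifP.
by apply/seteqP; split => [w Sw|w [l Sl] /= ->//]; exists (H w).
Qed.

Lemma measurable_countable_comp (phi : C -> R) :
  measurable_fun setT (fun w => phi (H w)).
Proof.
move=> _ B mB; rewrite setTI.
exact: (measurable_countable_preimage (phi @^-1` B)).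
Qed.

(** Conditioning on a random variable H with countably many values: if phi bounds
the conditional probability of A given H, then the integral of phi bounds the
probability of A. The hypothesis is multiplied out, so that the values of H of
probability zero need no care. *)
Lemma conditional_bound_integral (A : set T) (S : set C) (phi : C -> R) :
  measurable A -> (forall l, (0 <= phi l)%R) ->
  (forall l, S l -> P (A `&` [set w | H w = l]) <=
    (phi l)%:E * P [set w | H w = l]) ->
  P (A `&` [set w | S (H w)]) <=
  \int[P]_(w in [set w | S (H w)]) (phi (H w))%:E.
Proof.
move=> mA phi0 hA.
(* The events F m, indexed by the codes of the values of H, cut the event
S (H w) into pieces on which H is constant. *)
pose F m := [set w | S (H w) /\ pickle (H w) = m].
have mF m : measurable (F m).
  exact: (measurable_countable_preimage [set l | S l /\ pickle l = m]).
have FE : [set w | S (H w)] = \bigcup_m F m.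
  apply/seteqP; split=> [w Sw|w [m _ []]//].
  by exists (pickle (H w)).
have tF : trivIset setT F.
  apply/trivIsetP => i j _ _ /eqP ij; apply/seteqP; split=> // w [] /=.
  by move=> [_ wi] [_ wj]; case: ij; rewrite -wi -wj.
rewrite -[leLHS]integral_indic//; last exact: measurable_countable_preimage.
rewrite FE !ge0_integral_bigcup//; last 3 first.
- rewrite -FE; apply: measurable_funTS; apply/measurable_EFinP.
  exact: measurable_countable_comp.
- by move=> w _; rewrite lee_fin.
- exact/measurable_EFinP/measurable_indic.
apply: lee_nneseries => [m _ _|m _].
  by apply: integral_ge0 => w _; rewrite lee_fin.
rewrite integral_indic//.
have [->|/set0P[w0 [Sw0 w0m]]] := eqVneq (F m) set0.
  by rewrite setI0 measure0 integral_set0.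
have Fm : F m = [set w | H w = H w0].
  apply/seteqP; split => w /=; last by move=> ww0; rewrite /F/= ww0.
  by move=> [_ wm]; apply: (pcan_inj (@pickleK C)); rewrite wm w0m.
rewrite Fm (_ : \int[P]_(w in _) _ =
    \int[P]_(w in [set w | H w = H w0]) (phi (H w0))%:E).
  by rewrite integral_cst//; exact: hA.
by apply: eq_integral => w; rewrite inE/= => ->.
Qed.

End CountableConditioning.

(** The hypothesis on N says that phi (Y w) only matters for Y w < N. *)
Lemma ge0_integral_nat_sum d (T : measurableType d) (R : realType)
    (P : {measure set T -> \bar R}) (Y : {mfun T >-> nat}) (D : set T)
    (phi : nat -> R) (N : nat) :
  measurable D -> (forall i, 0 <= phi i) ->
  (forall w, D w -> (N <= Y w)%N -> phi (Y w) = 0) ->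
  (\int[P]_(w in D) (phi (Y w))%:E =
   \sum_(0 <= i < N) (phi i)%:E * P (D `&` [set w | Y w = i]))%E.
Proof.
move=> mD phi0 phiN.
have mY i : measurable [set w | Y w = i].
  exact: (@measurable_funPTI _ _ _ _ Y [set i]).
transitivity (\int[P]_(w in D)
    \sum_(0 <= i < N) ((phi i)%:E * (\1_[set w | Y w = i] w)%:E))%E.
  apply: eq_integral => w; rewrite inE => Dw.
  have [NY|YN] := leqP N (Y w).
    rewrite phiN// big_nat big1// => i /andP[_ iN].
    rewrite indicE memNset ?mule0//= => Ywi.
    by move: iN; rewrite -Ywi ltnNge NY.
  rewrite (big_rem (Y w)) ?mem_index_iota//= indicE mem_set// mule1.
  rewrite big_seq big1 ?adde0// => i.
  rewrite mem_rem_uniq ?iota_uniq// !inE => /andP[iY _].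
  by rewrite indicE memNset ?mule0//= => Ywi; move: iY; rewrite Ywi eqxx.
rewrite ge0_integral_sum//; last 2 first.
- move=> i; apply: emeasurable_funM => //.
  exact/measurable_EFinP/measurable_indic.
- by move=> i w _; rewrite mule_ge0// lee_fin.
apply: eq_bigr => i _; rewrite ge0_integralZl//; last 2 first.
- exact/measurable_EFinP/measurable_indic.
- by rewrite lee_fin.
by rewrite integral_indic// setIC.
Qed.

(** * Invariant measure and hitting times of the reflected walk *)

Lemma sum_nat_delta (R : pzSemiRingType) (f : nat -> R) (c : R) (N a : nat) :
  (a < N)%N -> \sum_(0 <= j < N) f j * (c *+ (j == a)) = f a * c.
Proof.
move=> aN; rewrite (bigD1_seq a) ?mem_index_iota ?iota_uniq//=.
by rewrite eqxx big1 ?addr0// => j /negbTE ->; rewrite mulr0.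
Qed.

Section WalkAlgebra.
Context {R : realType} (pup pdown : R).
Hypotheses (hpup : 0 < pup) (hpdown : 0 < pdown) (hsum : pup + pdown = 1).
Local Notation rho := (pdown / pup).
Hypothesis hrho : 1 < rho.

Lemma walk_step_ge0 i j : 0 <= walk_step pup pdown i j.
Proof.
case: i => [|i] /=; first by rewrite ler0n.
by rewrite addr_ge0// mulrn_wge0// ltW.
Qed.

Lemma walk_step_eq0 i j : (j.+2 <= i)%N -> walk_step pup pdown i j = 0.
Proof.
case: i => [|i] //=; rewrite ltnS => ji.
by rewrite (ltn_eqF ji) (ltn_eqF (leq_trans ji (leqW (leqnSn i)))) !mulr0n addr0.
Qed.

(** The invariant measure of the walk, normalized to have weight 1 at 0. The
reflection at 0 explains the separate value there. *)
Definition stationary_weight (j : nat) : R :=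
  if j is j'.+1 then rho ^- j / pup else 1.

Lemma stationary_weight_bounds j :
  rho ^- j <= stationary_weight j <= rho ^- j / pup.
Proof.
have pup1 : 1 <= pup^-1 by rewrite invf_ge1// -hsum lerDl ltW.
have r0 k : 0 <= rho ^- k by rewrite invr_ge0 exprn_ge0// divr_ge0// ltW.
case: j => [|j] /=; first by rewrite expr0 invr1 mul1r lexx.
by rewrite lexx ler_peMr.
Qed.

(** The sum over i < j + 2 contains all the states from which j can be reached in
one step. *)
Lemma stationary_weight_invariant j :
  \sum_(0 <= i < j.+2) walk_step pup pdown i j * stationary_weight i =
  stationary_weight j.
Proof.
have pu0 : pup != 0 by rewrite gt_eqF.
have pd0 : pdown != 0 by rewrite gt_eqF.
rewrite big_nat_recl//= mulr1.
under eq_bigr do rewrite mulrC mulrDr.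
rewrite big_split/=.
have e3 : \sum_(0 <= i < j.+1) stationary_weight i.+1 * (pdown *+ (j == i)) =
    stationary_weight j.+1 * pdown.
  by rewrite -(@sum_nat_delta _ (fun i => stationary_weight i.+1) pdown j.+1 j)//;
     apply: eq_bigr => i _; rewrite eq_sym.
rewrite [X in _ + (_ + X)]e3.
have hd : pdown = 1 - pup by rewrite -hsum addrC addKr.
case: j e3 => [|[|j]] _.
- rewrite !big_nat_recr//= big_geq//.
  by field; rewrite pu0 pd0.
- rewrite !big_nat_recr//= big_geq//.
  by rewrite hd; field; rewrite -hd pu0 pd0.
- rewrite [X in X + _](_ : _ = 0)// add0r.
  have -> : \sum_(0 <= i < j.+3)
      rho ^- i.+1 / pup * (pup *+ (j.+2 == i.+2)) = rho ^- j.+1 / pup * pup.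
    rewrite -(@sum_nat_delta _ (fun i => rho ^- i.+1 / pup) pup j.+3 j)//;
      last by rewrite ltnW.
    by apply: eq_bigr => i _; rewrite !eqSS eq_sym.
  rewrite /stationary_weight ![rho ^+ _.+1]exprS.
  have rj0 : rho ^+ j != 0 by rewrite expf_neq0// mulf_neq0 ?invr_eq0.
  move: (rho ^+ j) rj0 => r rj0.
  by rewrite hd; field; rewrite -hd pu0 pd0 rj0.
Qed.

(** Expected time to go up from x to x + 1: the solution of g(0) = 1 and
g(x) = 1 / pup + rho g(x - 1). *)
Definition upcrossing_time (x : nat) : R :=
  let B := (pup * (rho - 1))^-1 in (1 + B) * rho ^+ x - B.

(** Expected time to go up from 0 to x. *)
Definition hitting_potential (x : nat) : R :=
  \sum_(0 <= y < x) upcrossing_time y.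

Let B := (pup * (rho - 1))^-1.

Let B_ge0 : 0 <= B.
Proof. by rewrite invr_ge0 mulr_ge0 ?subr_ge0 ?(ltW hpup) ?(ltW hrho). Qed.

Lemma upcrossing_time_ge0 x : 0 <= upcrossing_time x.
Proof.
rewrite subr_ge0 (@le_trans _ _ (1 + B)) ?lerDr//.
by rewrite ler_peMr ?addr_ge0// exprn_ege1// ltW.
Qed.

Lemma hitting_potential_le x y : (x <= y)%N ->
  hitting_potential x <= hitting_potential y.
Proof.
move=> xy; rewrite /hitting_potential (big_cat_nat (leq0n x) xy)/= lerDl.
by apply: sumr_ge0 => i _; exact: upcrossing_time_ge0.
Qed.

Lemma hitting_potential_bound h :
  hitting_potential h <= (1 + B) / (rho - 1) * rho ^+ h.
Proof.
have r10 : rho - 1 != 0 by rewrite gt_eqF// subr_gt0.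
elim: h => [|h IH].
  rewrite /hitting_potential big_geq// expr0 mulr1 divr_ge0 ?subr_ge0 ?(ltW hrho)//.
  by rewrite addr_ge0.
rewrite /hitting_potential big_nat_recr//= -/(hitting_potential h).
apply: (@le_trans _ _ ((1 + B) / (rho - 1) * rho ^+ h + (1 + B) * rho ^+ h)).
  by rewrite lerD// /upcrossing_time -/B gerBl ?B_ge0.
rewrite exprS le_eqVlt; apply/orP; left; apply/eqP.
by move: B (rho ^+ h) (rho) r10 => b t r r10; field.
Qed.

(** From a state i < h, the expected time to reach h decreases by one on average
at each step. The state h may be left out of the sum since the expected time
vanishes there. *)
Lemma hitting_potential_drift h i : (i < h)%N ->
  \sum_(0 <= j < h) walk_step pup pdown i j *
    (hitting_potential h - hitting_potential j) =
  hitting_potential h - hitting_potential i - 1.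
Proof.
move=> ih; set F := fun j => hitting_potential h - hitting_potential j.
have pu0 : pup != 0 by rewrite gt_eqF.
have r10 : rho - 1 != 0 by rewrite gt_eqF// subr_gt0.
have hd : pdown = 1 - pup by rewrite -hsum addrC addKr.
(* The sum is extended to j = h, where F vanishes, so that it contains all the
states that can be reached from i. *)
have -> : \sum_(0 <= j < h) walk_step pup pdown i j * F j =
    \sum_(0 <= j < h.+1) F j * walk_step pup pdown i j.
  rewrite [RHS]big_nat_recr//= [F h]subrr mul0r addr0.
  by apply: eq_bigr => j _; rewrite mulrC.
have FS j : F j.+1 = F j - upcrossing_time j.
  rewrite /F {2}/hitting_potential big_nat_recr//= -/(hitting_potential j).
  by rewrite opprD addrA.
case: i ih => [|i] ih.
  rewrite -/(F 0%N) (sum_nat_delta F 1) ?ltnS// FS mulr1.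
  by rewrite /upcrossing_time expr0; ring.
under eq_bigr do rewrite /= mulrDr.
rewrite big_split/= !sum_nat_delta ?ltnS// ?(ltnW (ltnW ih))// -/(F i.+1) !FS.
rewrite /upcrossing_time exprS -/B.
have hB : pup * (rho - 1) * B = 1 by rewrite divff// mulf_neq0.
have hr : pup * rho = pdown by rewrite mulrC divfK.
have -> : (F i - ((1 + B) * rho ^+ i - B) - ((1 + B) * (rho * rho ^+ i) - B)) *
  pup + F i * pdown = F i * (pup + pdown)
   - pup * ((1 + B) * rho ^+ i - B) - ((1 + B) * ((pup * rho) * rho ^+ i) - pup * B).
  by ring.
rewrite hsum hr.
have -> : pup * B = pup * rho * B - 1.
  by rewrite -hB; ring.
rewrite hr hd; ring.
Qed.

End WalkAlgebra.

(** * Marginals and maximum of the walk *)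

Section History.
Context {T : Type}.
Implicit Type X : nat -> T -> nat.

(** The list of the first n + 1 states, from time 0 to time n. *)
Definition history X (n : nat) (w : T) : seq nat := mkseq (fun k => X k w) n.+1.

Lemma nth_history X n w k : (k <= n)%N -> nth 0%N (history X n w) k = X k w.
Proof. by move=> kn; rewrite nth_mkseq. Qed.

Lemma history_eq X n l : size l = n.+1 ->
  [set w | history X n w = l] =
  [set w | forall k, (k <= n)%N -> X k w = nth 0%N l k].
Proof.
move=> sl; apply/seteqP; split => w /=.
  by move=> <- k kn; rewrite nth_history.
move=> h; apply: (@eq_from_nth _ 0%N); rewrite size_mkseq// => k kn.
by rewrite nth_mkseq// h.
Qed.

Lemma history_neq X n l : size l <> n.+1 -> [set w | history X n w = l] = set0.
Proof.
by move=> sl; apply/seteqP; split => // w /= wl; case: sl; rewrite -wl size_mkseq.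
Qed.

End History.

Lemma measurable_history d (T : measurableType d) (X : nat -> T -> nat) n l :
  (forall k i, measurable [set w | X k w = i]) ->
  measurable [set w | history X n w = l].
Proof.
move=> mX; have [sl|sl] := eqVneq (size l) n.+1; last first.
  by rewrite history_neq//; exact/eqP.
rewrite history_eq//.
rewrite (_ : [set _ | _] =
    \bigcap_(k in `I_n.+1) [set w | X k w = nth 0%N l k]).
  by apply: fin_bigcap_measurable.
by apply/seteqP; split => w /= h k; [rewrite /= ltnS|]; exact: h.
Qed.

Section MarkovChain.
Context d (T : measurableType d) (R : realType) (P : probability T R).
Variables (nu : probability nat R) (p : nat -> nat -> R).
Variables (X : nat -> {RV P >-> nat}).
Hypothesis hX : markov_chain nu p X.
Hypothesis p0 : forall i j, 0 <= p i j.

Local Notation hist := (history (fun k => X k : T -> nat)).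

Lemma measurable_state k i : measurable [set w | X k w = i].
Proof. exact: (@measurable_funPTI _ _ _ _ (X k) [set i]). Qed.

Lemma measurable_hist n (S : set (seq nat)) :
  measurable [set w | S (hist n w)].
Proof.
apply: measurable_countable_preimage => l; apply: measurable_history.
exact: measurable_state.
Qed.

(** One step of the chain, jointly with an event S of the past. Only the states
below N contribute to the state j. *)
Lemma markov_transition_le (n : nat) (S : set (seq nat)) (j N : nat) :
  (forall w, S (hist n w) -> (N <= X n w)%N -> p (X n w) j = 0) ->
  (P ([set w | X n.+1 w = j] `&` [set w | S (hist n w)]) <=
   \sum_(0 <= i < N)
      (p i j)%:E * P ([set w | S (hist n w)] `&` [set w | X n w = i]))%E.
Proof.
move=> hN.
rewrite -ge0_integral_nat_sum//; last exact: measurable_hist.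
rewrite (_ : \int[P]_(w in _) _ = \int[P]_(w in [set w | S (hist n w)])
    (p (nth 0%N (hist n w) n) j)%:E)%E; last first.
  by apply: eq_integral => w _; rewrite nth_history.
have mH l : measurable [set w | hist n w = l].
  by apply: measurable_history; exact: measurable_state.
apply: (conditional_bound_integral mH (phi := fun l => p (nth 0%N l n) j)).
- exact: measurable_state.
- by move=> l; exact: p0.
move=> l Sl; have [sl|sl] := eqVneq (size l) n.+1; last first.
  by rewrite history_neq ?setI0 ?measure0 ?mule0//; exact/eqP.
rewrite history_eq// muleC -hX.2 le_eqVlt; apply/orP; left; apply/eqP.
by congr (P _); rewrite setIC.
Qed.

End MarkovChain.

Section WalkBounds.
Context d (T : measurableType d) (R : realType) (P : probability T R).
Context (pup pdown : R).
Hypotheses (hpup : 0 < pup) (hpdown : 0 < pdown) (hsum : pup + pdown = 1).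
Local Notation rho := (pdown / pup).
Hypothesis hrho : 1 < rho.
Context (nu : probability nat R) (X : nat -> {RV P >-> nat}).
Hypothesis hX : markov_chain nu (walk_step pup pdown) X.
Local Notation hist := (history (fun k => X k : T -> nat)).

Let rho0 : 0 < rho. Proof. exact: lt_trans hrho. Qed.

Let mstate := measurable_state X.
Let mhist := measurable_hist X.

(** At time 0 the bound holds because rho ^ K times the stationary weight is at
least 1 on the states at most K; invariance propagates it. *)
Lemma walk_marginal_le (K k j : nat) :
  (P ([set w | (X 0%N w <= K)%N] `&` [set w | X k w = j]) <=
   (rho ^+ K * stationary_weight pup pdown j)%:E)%E.
Proof.
have rK n : 1 <= rho ^+ n by rewrite exprn_ege1// ltW.
elim: k j => [|k IH] j.
  have [jK|Kj] := leqP j K; last first.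
    rewrite (_ : _ `&` _ = set0) ?measure0 ?lee_fin.
      rewrite mulr_ge0 ?(le_trans _ (rK K))//.
      have /andP[+ _] := stationary_weight_bounds hpup hpdown hsum j.
      by apply: le_trans; rewrite invr_ge0 (le_trans _ (rK j)).
    apply/seteqP; split => // w /= [wK wj].
    by move: Kj; rewrite -wj ltnNge wK.
  apply: (@le_trans _ _ 1%E).
    by apply: probability_le1; apply: measurableI => //;
       exact: (@measurable_funPTI _ _ _ _ (X 0%N) [set i | (i <= K)%N]).
  rewrite lee_fin.
  have /andP[+ _] := stationary_weight_bounds hpup hpdown hsum j.
  move=> /(ler_wpM2l (le_trans ler01 (rK K))); apply: le_trans.
  by rewrite ler_pdivlMr ?exprn_gt0// mul1r ler_eXn2l.
pose S : set (seq nat) := [set l | (nth 0 l 0 <= K)%N].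
have SE : [set w | S (hist k w)] = [set w | (X 0%N w <= K)%N].
  by [].
rewrite setIC -SE.
apply: (le_trans (markov_transition_le (N := j.+2) hX _ _)).
- exact: walk_step_ge0.
- by move=> w _; exact: walk_step_eq0.
rewrite -(stationary_weight_invariant hpup hpdown hsum) mulr_sumr -sumEFin.
apply: lee_sum => i _; rewrite SE mulrCA EFinM lee_wpmul2l//.
by rewrite lee_fin walk_step_ge0.
Qed.

Lemma walk_tail_le (K k h : nat) :
  (P ([set w | (X 0%N w <= K)%N] `&` [set w | (h <= X k w)%N]) <=
   (rho ^+ K / pup / (1 - rho^-1) * rho ^- h)%:E)%E.
Proof.
pose F j := [set w | (X 0%N w <= K)%N] `&` [set w | X k w = (h + j)%N].
have m0 : measurable [set w | (X 0%N w <= K)%N].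
  exact: (@measurable_funPTI _ _ _ _ (X 0%N) [set i | (i <= K)%N]).
have mF j : measurable (F j) by apply: measurableI.
have q1 : rho^-1 < 1 by rewrite invf_lt1.
have q0 : 0 < rho^-1 by rewrite invr_gt0.
apply: (@le_trans _ _ (\sum_(0 <= j <oo) P (F j))%E).
  apply: measure_sigma_subadditive => //.
    apply: measurableI => //.
    exact: (@measurable_funPTI _ _ _ _ (X k) [set i | (h <= i)%N]).
  move=> w /= [wK hw]; exists (X k w - h)%N => //=.
  by split => //=; rewrite subnKC.
apply: lime_le; first exact: is_cvg_nneseries.
apply: nearW => m.
apply: (@le_trans _ _ (\sum_(0 <= j < m)
    (rho ^+ K / pup * rho ^- h * (rho^-1) ^+ j)%:E)%E).
  apply: lee_sum => j _; apply: (le_trans (walk_marginal_le _ _ _)).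
  rewrite lee_fin -!mulrA ler_wpM2l ?exprn_ge0 ?(ltW rho0)//.
  have /andP[_ +] := stationary_weight_bounds hpup hpdown hsum (h + j).
  move=> /le_trans; apply; rewrite exprD invfM exprVn le_eqVlt.
  by apply/orP; left; apply/eqP; ring.
rewrite sumEFin lee_fin -mulr_sumr.
rewrite [leRHS](_ : _ = rho ^+ K / pup * rho ^- h * (1 - rho^-1)^-1); last first.
  by rewrite mulrAC.
rewrite ler_wpM2l//.
  by rewrite !mulr_ge0 ?invr_ge0 ?exprn_ge0 ?(ltW rho0) ?(ltW hpup).
rewrite -[leRHS]mul1r ler_pdivlMr ?subr_gt0//.
have -> : (\sum_(0 <= j < m) rho^-1 ^+ j) * (1 - rho^-1) = 1 - rho^-1 ^+ m.
  by rewrite -[RHS]opprB subrX1 big_mkord -mulNr opprB mulrC.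
by rewrite gerBl exprn_ge0// ltW.
Qed.

Let F h j := hitting_potential pup pdown h - hitting_potential pup pdown j.

(** Optional stopping at the hitting time of h, written with the probabilities
q k of staying below h up to time k and the probabilities a k i of being moreover
at i at time k. *)
Lemma walk_stays_below_le (h n : nat) :
  (P [set w | forall k, (k <= n)%N -> (X k w < h)%N] <=
   (hitting_potential pup pdown h / n.+1%:R)%:E)%E.
Proof.
pose S : set (seq nat) := [set l | all (fun i => i < h)%N l].
pose a k i := fine (P ([set w | S (hist k w)] `&` [set w | X k w = i])).
pose q k := fine (P [set w | S (hist k w)]).
have SE k : [set w | S (hist k w)] =
    [set w | forall i, (i <= k)%N -> (X i w < h)%N].
  apply/seteqP; split => w hw.
    move=> i ik; rewrite -(@nth_history _ (fun k => X k : T -> nat) k w)//.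
    by apply: (all_nthP 0%N hw); rewrite size_mkseq ltnS.
  apply/(all_nthP 0%N : reflect _ (all _ (hist k w))) => i.
  by rewrite size_mkseq ltnS => ik; rewrite nth_history//; exact: hw.
have aE k i : P ([set w | S (hist k w)] `&` [set w | X k w = i]) = (a k i)%:E.
  by rewrite /a fineK// fin_num_measure//; apply: measurableI.
have qE k : P [set w | S (hist k w)] = (q k)%:E.
  by rewrite /q fineK// fin_num_measure.
have Slt k w : S (hist k w) -> (X k w < h)%N.
  by rewrite -[S _]/([set w | S (hist k w)] w) SE => /(_ k (leqnn _)).
have a0 k i : 0 <= a k i by rewrite -lee_fin -aE measure_ge0.
have qa k : q k = \sum_(0 <= i < h) a k i.
  have := @ge0_integral_nat_sum _ _ _ P (X k) [set w | S (hist k w)]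
    (fun i => (i < h)%N%:R) h (mhist _ _) (fun=> ler0n _ _).
  rewrite (_ : \int[P]_(w in _) _ = \int[P]_(w in [set w | S (hist k w)]) 1)%E.
    rewrite integral_cst//= mul1e qE => qk.
    apply: EFin_inj; rewrite qk; last first.
      by move=> w Sw; rewrite leqNgt Slt.
    rewrite -sumEFin big_nat [RHS]big_nat; apply: eq_bigr => i /andP[_ ih].
    by rewrite ih mul1e aE.
  by apply: eq_integral => w; rewrite inE => /Slt ->.
have q_noninc k : q k.+1 <= q k.
  rewrite -lee_fin -!qE !SE le_measure ?inE//; try by rewrite -SE.
  by move=> w/= hw i ik; apply: hw; rewrite (leq_trans ik).
have F0 j : (j <= h)%N -> 0 <= F h j.
  by move=> jh; rewrite subr_ge0 hitting_potential_le.
(* The expected remaining time to reach h decreases by q k at step k. *)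
have step k : \sum_(0 <= j < h) F h j * a k.+1 j + q k <=
    \sum_(0 <= i < h) F h i * a k i.
  have astep j : (j < h)%N ->
      a k.+1 j <= \sum_(0 <= i < h) walk_step pup pdown i j * a k i.
    move=> jh; rewrite -lee_fin -aE -sumEFin.
    under eq_bigr do rewrite EFinM -aE.
    apply: (le_trans _ (markov_transition_le hX _ _)); last 2 first.
    - exact: walk_step_ge0.
    - by move=> w /Slt; rewrite ltnNge => /negbTE ->.
    rewrite le_measure ?inE//; do ?by apply: measurableI.
    move=> w/= [+ wj]; rewrite -[S _]/([set w | S (hist k.+1 w)] w) SE => hw.
    split=> //; rewrite -[S _]/([set w | S (hist k w)] w) SE => i ik.
    by apply: hw; rewrite ltnW.
  apply: (@le_trans _ _ (\sum_(0 <= j < h) F h j *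
      (\sum_(0 <= i < h) walk_step pup pdown i j * a k i) + q k)).
    rewrite lerD2r !big_nat; apply: ler_sum => j /andP[_ jh].
    by rewrite ler_wpM2l ?astep// F0// ltnW.
  under eq_bigr do rewrite mulr_sumr.
  rewrite exchange_big/= qa -big_split/= le_eqVlt; apply/orP; left; apply/eqP.
  rewrite !big_nat; apply: eq_bigr => i /andP[_ ih].
  rewrite (_ : \sum_(0 <= j < h) _ =
      (\sum_(0 <= j < h) walk_step pup pdown i j * F h j) * a k i); last first.
    by rewrite mulr_suml; apply: eq_bigr => j _; ring.
  by rewrite hitting_potential_drift// -/(F h i); ring.
have total m : \sum_(0 <= k < m) q k + \sum_(0 <= j < h) F h j * a m j <=
    \sum_(0 <= j < h) F h j * a 0%N j.
  elim: m => [|m IH]; first by rewrite big_geq// add0r.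
  rewrite big_nat_recr//=; apply: le_trans IH; rewrite -addrA lerD2l addrC.
  exact: step.
have qle m k : (k <= m)%N -> q m <= q k.
  elim: m => [|m IH]; first by rewrite leqn0 => /eqP ->.
  rewrite leq_eqVlt => /predU1P[->//|km].
  by rewrite (le_trans (q_noninc m))// IH.
have q1 : q 0%N <= 1 by rewrite -lee_fin -qE probability_le1.
have H0 : 0 <= hitting_potential pup pdown h.
  by apply: sumr_ge0 => i _; exact: upcrossing_time_ge0.
rewrite -SE qE lee_fin ler_pdivlMr//.
apply: (@le_trans _ _ (\sum_(0 <= k < n.+1) q k)).
  rewrite mulr_natr -[X in _ *+ X]subn0 -sumr_const_nat !big_nat.
  by apply: ler_sum => k /andP[_ kn]; exact: qle.
apply: (@le_trans _ _ (\sum_(0 <= j < h) F h j * a 0%N j)).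
  apply: le_trans (total n.+1); rewrite lerDl !big_nat.
  by apply: sumr_ge0 => j /andP[_ jh]; rewrite mulr_ge0 ?F0// ltnW.
apply: (@le_trans _ _ (hitting_potential pup pdown h * q 0%N)).
  rewrite qa mulr_sumr; apply: ler_sum => j _.
  rewrite ler_wpM2r// /F gerBl.
  by apply: sumr_ge0 => i _; exact: upcrossing_time_ge0.
by rewrite ler_piMr.
Qed.

End WalkBounds.

(** * The weighted sum given the path *)

Section GeneratedSigmaAlgebra.
Context d (T : measurableType d) (R : realType) (P : probability T R).

Lemma sigma_rvs_lincomb (X : nat -> {RV P >-> R}) a s (B : set R) :
  measurable B -> sigma_rvs X (lincomb X a s @^-1` B).
Proof.
move=> mB.
pose G := \bigcup_k preimage_set_system setT (X k) measurable.
pose T' := g_sigma_algebraType G.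
have mX k : measurable_fun setT (X k : T' -> R).
  move=> _ C mC; apply: sub_sigma_algebra; exists k => //; exists C => //.
have ml : measurable_fun setT (lincomb X a s : T' -> R).
  by apply: (@measurable_sum _ T') => k; exact: measurable_funM.
rewrite -[X in sigma_rvs _ X]setTI; exact: ml.
Qed.

Lemma sigma_rvs_history (X : nat -> {RV P >-> nat}) n l :
  sigma_rvs X [set w | history (fun k => X k : T -> nat) n w = l].
Proof.
pose G := \bigcup_k preimage_set_system setT (X k) measurable.
pose T' := g_sigma_algebraType G.
apply: (@measurable_history _ T') => k i.
by apply: sub_sigma_algebra; exists k => //; exists [set i] => //; rewrite setTI.
Qed.

End GeneratedSigmaAlgebra.

Section WeightedSum.
Context (R : realType) (Lambda : R).
Context d (T : measurableType d) (P : probability T R).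
Variables (L : nat -> {RV P >-> nat}) (xi : nat -> {RV P >-> R}).
Hypothesis hxiL_indep : independent_sigma P (sigma_rvs xi) (sigma_rvs L).

Local Notation hist := (history (fun k => L k : T -> nat)).
Local Notation M := (weighted_sum Lambda L xi).

Lemma measurable_weighted_sum n : measurable_fun setT (M n).
Proof.
apply: measurable_sum => k; apply: measurable_funM => //.
apply: (measurable_countable_comp (H := L k) _ (fun i => Lambda ^+ i)).
exact: measurable_state.
Qed.

Lemma weighted_sum_lincomb n w :
  M n.+1 w =
  lincomb xi (fun k => Lambda ^+ nth 0%N (hist n w) k) (index_iota 0 n.+1) w.
Proof.
rewrite /weighted_sum /lincomb big_nat [RHS]big_nat.
apply: eq_bigr => k /andP[_ kn].
by rewrite nth_history.
Qed.

(** Freezing the path: given the history l of the walk, the weighted sum is a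
linear combination of the variables xi with the deterministic coefficients
Lambda ^ l_k, whose law is unaffected by the conditioning. *)
Lemma weighted_sum_conditioning n (Q : set R) (S : set (seq nat))
    (phi : seq nat -> R) :
  measurable Q -> (forall l, 0 <= phi l) ->
  (forall l, S l -> size l = n.+1 ->
    (P [set w | Q (lincomb xi (fun k => (Lambda ^+ nth 0%N l k)%R)
       (index_iota 0 n.+1) w)] <= (phi l)%:E)%E) ->
  (P ([set w | Q (M n.+1 w)] `&` [set w | S (hist n w)]) <=
   \int[P]_(w in [set w | S (hist n w)]) (phi (hist n w))%:E)%E.
Proof.
move=> mQ phi0 hphi.
have mH l : measurable [set w | hist n w = l].
  by apply: measurable_history; exact: measurable_state.
apply: (conditional_bound_integral mH) => //.
  by rewrite -[X in measurable X]setTI; exact: measurable_weighted_sum.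
move=> l Sl; have [sl|sl] := eqVneq (size l) n.+1; last first.
  by rewrite history_neq ?setI0 ?measure0 ?mule0//; exact/eqP.
rewrite (_ : _ `&` _ = [set w | Q (lincomb xi (fun k => Lambda ^+ nth 0%N l k)
       (index_iota 0 n.+1) w)] `&` [set w | hist n w = l]).
  have hA := @sigma_rvs_lincomb _ _ _ _ xi (fun k => Lambda ^+ nth 0%N l k)
    (index_iota 0 n.+1) _ mQ.
  have hB := @sigma_rvs_history _ _ _ _ L n l.
  by rewrite [leLHS](hxiL_indep hA hB) lee_wpmul2r// hphi.
by apply/seteqP; split => w /= [+ wl]; rewrite weighted_sum_lincomb wl.
Qed.

End WeightedSum.

Section WeightedSumBounds.
Context (R : realType) (Lambda pup pdown : R).
Hypotheses (hLambda : 1 < Lambda) (hpup : 0 < pup) (hpdown : 0 < pdown).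
Hypothesis hsum : pup + pdown = 1.
Local Notation rho := (pdown / pup).
Hypotheses (hrho : 1 < rho) (hrho2 : rho < Lambda ^+ 2).
Context (nu : probability nat R).
Context d (T : measurableType d) (P : probability T R).
Context (L : nat -> {RV P >-> nat}) (xi : nat -> {RV P >-> R}).
Hypothesis hL : markov_chain nu (walk_step pup pdown) L.
Hypothesis hxi_law : forall k : nat, has_law (xi k) (normal_prob 0 1).
Hypothesis hxi_indep : independent_seq xi.
Hypothesis hxiL_indep : independent_sigma P (sigma_rvs xi) (sigma_rvs L).

Local Notation hist := (history (fun k => L k : T -> nat)).
Local Notation M := (weighted_sum Lambda L xi).

Let Lambda_ge1 : 1 <= Lambda. Proof. exact: ltW. Qed.
Let Lambda_gt0 i : 0 < Lambda ^+ i.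
Proof. by rewrite exprn_gt0// (lt_trans _ hLambda). Qed.
Let rho0 : 0 < rho. Proof. exact: lt_trans hrho. Qed.

(** The first term is the probability that the walk stays below h, the second one
the small ball bound once a coefficient at least Lambda ^ h is present. *)
Lemma weighted_sum_small_ball (h n : nat) (x : R) : 0 <= x ->
  (P [set w | (`|M n.+1 w| <= x)%R] <=
   (hitting_potential pup pdown h / n.+1%:R +
    normal_peak 1 * (2 * x / Lambda ^+ h))%:E)%E.
Proof.
move=> x0.
set low := [set w | forall k, (k <= n)%N -> (L k w < h)%N].
pose S : set (seq nat) := [set l | exists2 k, (k <= n)%N & (h <= nth 0%N l k)%N].
have SE : [set w | S (hist n w)] = ~` low.
  apply/seteqP; split => w.
    move=> [k kn]; rewrite nth_history// => hk /(_ k kn).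
    by rewrite ltnNge hk.
  move=> /existsNP[k /not_implyP[kn /negP]]; rewrite -leqNgt => hk.
  by exists k => //; rewrite nth_history.
have mS : measurable [set w | S (hist n w)] by exact: measurable_hist.
have mlow : measurable low by rewrite -[low]setCK -SE; exact: measurableC.
pose Q : set R := [set y | `|y| <= x].
have QE : Q = `[- x, x]%classic.
  by apply/seteqP; split => y; rewrite /Q/= in_itv/= ler_norml.
have mQ : measurable Q by rewrite QE.
have mM : measurable [set w | Q (M n.+1 w)].
  by rewrite -[X in measurable X]setTI; exact: measurable_weighted_sum.
pose c := normal_peak 1 * (2 * x / Lambda ^+ h).
have c0 : 0 <= c.
  by rewrite mulr_ge0 ?normal_peak_ge0 ?divr_ge0 ?mulr_ge0 ?(ltW (Lambda_gt0 h)).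
rewrite (_ : [set w | _] = ([set w | Q (M n.+1 w)] `&` low) `|`
    ([set w | Q (M n.+1 w)] `&` [set w | S (hist n w)])); last first.
  by rewrite SE -setIUr setUv setIT.
rewrite EFinD; apply: (le_trans (measureU2 _ _ _)).
- exact: measurableI.
- exact: measurableI.
apply: leeD.
  apply: le_trans (walk_stays_below_le hpup hpdown hsum hrho hL h n).
  by apply: le_measure; rewrite ?inE//; exact: measurableI.
apply: (@le_trans _ _ (\int[P]_(w in [set w | S (hist n w)]) c%:E)%E).
  apply: (@weighted_sum_conditioning _ _ _ _ _ L xi hxiL_indep n Q S (fun=> c)) => //.
  move=> l [k kn hk] sl.
  apply: (le_trans (lincomb_small_ball hxi_indep hxi_law (k := k) _ _ _ _)) => //.
  - exact: iota_uniq.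
  - by rewrite mem_index_iota ltnS.
  rewrite lee_fin ler_wpM2l ?normal_peak_ge0// ler_wpM2l ?mulr_ge0//.
  by rewrite lef_pV2 ?posrE// ler_weXn2l.
rewrite integral_cst// -[leRHS]mule1 lee_wpmul2l ?lee_fin//.
exact: probability_le1.
Qed.

(** The three terms bound the probabilities that the walk starts above K, that it
starts at most at K and reaches h, and that |M| > x although it starts at most at
K and stays below h. *)
Lemma weighted_sum_tail (C : R) (K h n : nat) (x : R) : 0 <= C -> 0 < x ->
  (\int[normal_prob (0:R) 1]_x (x ^+ 2)%:E <= C%:E)%E ->
  (P [set w | (x < `|M n.+1 w|)%R] <=
   P [set w | (K < L 0%N w)%N] +
   (n.+1%:R * (rho ^+ K / pup / (1 - rho^-1) * rho ^- h) +
    C / x ^+ 2 * (n.+1%:R *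
      (rho ^+ K / pup * ((Lambda ^+ 2 / rho) ^+ h / (Lambda ^+ 2 / rho - 1)))))%:E)%E.
Proof.
move=> C0 x0 hC.
pose q := Lambda ^+ 2 / rho.
have q1 : 1 < q by rewrite ltr_pdivlMr// mul1r.
pose start := [set w | (L 0%N w <= K)%N].
pose high k := start `&` [set w | (h <= L k w)%N].
pose up := \big[setU/set0]_(k < n.+1) high k.
pose S : set (seq nat) := [set l | (nth 0%N l 0 <= K)%N /\
  forall k, (k <= n)%N -> (nth 0%N l k < h)%N].
pose Q : set R := [set y | x < `|y|].
have mQ : measurable Q.
  rewrite (_ : Q = (fun y : R => `|y|) @^-1` `]x, +oo[%classic).
    by rewrite -[X in measurable X]setTI; exact: normr_measurable.
  by apply/seteqP; split => w/=; rewrite in_itv/= andbT.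
have mM : measurable [set w | Q (M n.+1 w)].
  by rewrite -[X in measurable X]setTI; exact: measurable_weighted_sum.
have mstart : measurable start.
  exact: (@measurable_funPTI _ _ _ _ (L 0%N) [set i | (i <= K)%N]).
have mhi k : measurable [set w | (h <= L k w)%N].
  exact: (@measurable_funPTI _ _ _ _ (L k) [set i | (h <= i)%N]).
have mup : measurable up.
  by apply: bigsetU_measurable => k _; exact: measurableI.
have mS : measurable [set w | S (hist n w)] by exact: measurable_hist.
have msC : measurable [set w | (K < L 0%N w)%N].
  exact: (@measurable_funPTI _ _ _ _ (L 0%N) [set i | (K < i)%N]).
have mQS := measurableI _ _ mM mS.
apply: (@le_trans _ _ (P ([set w | (K < L 0%N w)%N] `|` (up `|`
    ([set w | Q (M n.+1 w)] `&` [set w | S (hist n w)]))))).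
  apply: le_measure; rewrite ?inE//; first by do 2 apply: measurableU => //.
  move=> w Mw; have [wK|Kw] := leqP (L 0%N w) K; last by left.
  right; have [wup|wup] := pselect (up w); [by left|right; split=> //].
  split; first by rewrite nth_history.
  move=> k kn; rewrite nth_history// ltnNge; apply/negP => hk; apply: wup.
  have kn' : (k < n.+1)%N by rewrite ltnS.
  by rewrite /up -bigcup_mkord; exists k.
apply: (le_trans (measureU2 _ _ _)) => //; first exact: measurableU.
rewrite leeD2l//.
apply: (le_trans (measureU2 _ _ _)) => //; rewrite EFinD leeD//.
  apply: (le_trans (Boole_inequality _ _)).
    by move=> k _; exact: measurableI.
  apply: (@le_trans _ _ (\sum_(k < n.+1)
      (rho ^+ K / pup / (1 - rho^-1) * rho ^- h)%:E)%E).
    by apply: lee_sum => k _; exact: (walk_tail_le hpup hpdown hsum hrho hL).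
  by rewrite sumEFin sumr_const card_ord lee_fin mulr_natl.
pose c := C / x ^+ 2.
have c0 : 0 <= c by rewrite divr_ge0 ?exprn_ge0 ?(ltW x0).
pose V (l : seq nat) := \sum_(0 <= k < n.+1) (Lambda ^+ nth 0%N l k) ^+ 2.
have V0 l : 0 <= V l by apply: sumr_ge0 => k _; rewrite sqr_ge0.
apply: (@le_trans _ _ (\int[P]_(w in [set w | S (hist n w)])
    (c * V (hist n w))%:E)%E).
  apply: (@weighted_sum_conditioning _ _ _ _ _ L xi hxiL_indep n Q S
    (fun l => c * V l)) => //.
    by move=> l; rewrite mulr_ge0.
  move=> l _ _.
  apply: (le_trans (lincomb_tail hxi_indep hxi_law _ C0 hC (iota_uniq _ _) x0)).
  by rewrite lee_fin mulrAC.
have mL k : measurable_fun setT (fun w => (Lambda ^+ L k w) ^+ 2).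
  apply: (measurable_countable_comp (H := L k) _ (fun i => (Lambda ^+ i) ^+ 2)).
  exact: measurable_state.
rewrite (_ : \int[P]_(w in _) _ = \int[P]_(w in [set w | S (hist n w)])
    (c%:E * \sum_(0 <= k < n.+1) ((Lambda ^+ L k w) ^+ 2)%:E))%E; last first.
  apply: eq_integral => w _; rewrite sumEFin -EFinM; congr (_ * _)%:E.
  rewrite /V !big_nat; apply: eq_bigr => k /andP[_ kn].
  by rewrite nth_history.
rewrite ge0_integralZl//; last 2 first.
- apply: emeasurable_sum => k; apply/measurable_funTS/measurable_EFinP.
  exact: mL.
- by move=> w _; rewrite sumEFin lee_fin sumr_ge0// => k _; rewrite sqr_ge0.
rewrite [leRHS]EFinM lee_wpmul2l//.
rewrite ge0_integral_sum//; last 2 first.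
- by move=> k; apply/measurable_funTS/measurable_EFinP; exact: mL.
- by move=> k w _; rewrite lee_fin sqr_ge0.
rewrite -[X in (X%:R * _)%:E]subn0 mulr_natl -sumr_const_nat -sumEFin.
rewrite !big_nat; apply: lee_sum => k /andP[_ kn].
have lt_h w : S (hist n w) -> (L k w < h)%N.
  by move=> [_ /(_ k kn)]; rewrite nth_history.
(* The truncation at h is free, as the walk stays below h on the event. *)
pose phi i : R := (Lambda ^+ i) ^+ 2 *+ (i < h)%N.
have phi0 i : 0 <= phi i by rewrite mulrn_wge0// sqr_ge0.
rewrite (_ : \int[P]_(w in _) _ =
    \int[P]_(w in [set w | S (hist n w)]) (phi (L k w))%:E)%E; last first.
  by apply: eq_integral => w; rewrite inE /phi => /lt_h ->.
rewrite (@ge0_integral_nat_sum _ _ _ P (L k) _ phi h)//; last first.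
  by move=> w _; rewrite /phi leqNgt => /negbTE ->; rewrite mulr0n.
apply: (@le_trans _ _ (\sum_(0 <= i < h) (rho ^+ K / pup * q ^+ i)%:E)%E).
  apply: lee_sum => i _.
  have le1 : (P ([set w | S (hist n w)] `&` [set w | L k w = i]) <=
      (rho ^+ K * (rho ^- i / pup))%:E)%E.
    apply: (@le_trans _ _ (P (start `&` [set w | L k w = i]))).
      apply: le_measure; rewrite ?inE//;
        do ?by apply: measurableI => //; exact: measurable_state.
      by move=> w [[wK _] wi]; split => //; move: wK; rewrite nth_history.
    apply: (le_trans (walk_marginal_le hpup hpdown hsum hrho hL K k i)).
    rewrite lee_fin ler_wpM2l ?exprn_ge0 ?(ltW rho0)//.
    by have /andP[] := stationary_weight_bounds hpup hpdown hsum i.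
  apply: (le_trans (lee_wpmul2l _ le1)); first by rewrite lee_fin.
  rewrite -EFinM lee_fin.
  apply: (@le_trans _ _ ((Lambda ^+ i) ^+ 2 * (rho ^+ K * (rho ^- i / pup)))).
    rewrite ler_wpM2r//.
      by rewrite !mulr_ge0 ?invr_ge0 ?exprn_ge0 ?(ltW rho0) ?(ltW hpup).
    by rewrite /phi; case: (i < h)%N => //; rewrite mulr0n sqr_ge0.
  rewrite /q (expr_div_n (Lambda ^+ 2)) -!exprM mulnC le_eqVlt.
  by apply/orP; left; apply/eqP; ring.
rewrite sumEFin lee_fin -mulr_sumr ler_wpM2l//.
  by rewrite !mulr_ge0 ?invr_ge0 ?exprn_ge0 ?(ltW rho0) ?(ltW hpup).
rewrite ler_pdivlMr ?subr_gt0// mulrC big_mkord -subrX1.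
by rewrite gerBl.
Qed.

End WeightedSumBounds.

(** * Asymptotics at the critical exponent *)

Lemma cvge0_of_eventually_le (R : realType) (u : nat -> \bar R) :
  (forall n, 0 <= u n)%E ->
  (forall eta : R, 0 < eta -> \forall n \near \oo, (u n <= eta%:E)%E) ->
  u n @[n --> \oo] --> 0%E.
Proof.
move=> u0 hu; apply/fine_cvgP; split.
  have := hu 1 ltr01; apply: filterS => n un.
  by rewrite ge0_fin_numE// (le_lt_trans un)// ltry.
apply/cvgr0Pnorm_le => eta eta0; have := hu eta eta0; apply: filterS => n un.
rewrite /= ger0_norm ?fine_ge0// -lee_fin fineK//.
by rewrite ge0_fin_numE// (le_lt_trans un)// ltry.
Qed.

Lemma exists_log_floor (R : realType) (rho y : R) : 1 < rho -> 1 <= y ->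
  exists h : nat, rho ^+ h <= y < rho ^+ h.+1.
Proof.
move=> rho1 y1.
have bern n : n%:R * (rho - 1) <= rho ^+ n.
  elim: n => [|n IH]; first by rewrite mul0r.
  have : 1 <= rho ^+ n by rewrite exprn_ege1// ltW.
  rewrite exprS -natr1; nra.
have ex : exists n, y < rho ^+ n.
  exists (Num.truncn (y / (rho - 1))).+1.
  apply: lt_le_trans (bern _); rewrite -ltr_pdivrMr ?subr_gt0//.
  exact: truncnS_gt.
case: (ex_minnP ex) => -[|h] yh hmin; first by move: yh; rewrite expr0 ltNge y1.
exists h; rewrite yh andbT leNgt; apply/negP => /hmin.
by rewrite ltnn.
Qed.

Section CriticalExponent.
Context (R : realType) (Lambda pup pdown : R).
Hypothesis hLambda : 1 < Lambda.
Local Notation rho := (pdown / pup).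
Hypothesis hrho : 1 < rho.
Local Notation s := (critical_exponent Lambda pup pdown)^-1.

Lemma critical_exponent_gt0 : 0 < s.
Proof. by rewrite invr_gt0 divr_gt0// ln_gt0. Qed.

(** The exponent 1 / alpha turns the growth rate rho into Lambda. *)
Lemma powR_critical_exponent h : (rho ^+ h) `^ s = Lambda ^+ h.
Proof.
have L0 : 0 < Lambda by exact: lt_trans hLambda.
have r0 : 0 < rho by exact: lt_trans hrho.
have rs : rho `^ s = Lambda.
  rewrite /powR gt_eqF// /critical_exponent invf_div divfK ?lnK ?posrE//.
  by rewrite gt_eqF// ln_gt0.
by rewrite -powR_mulrn ?ltW// -powRrM [h%:R * s]mulrC powRrM rs powR_mulrn// ltW.
Qed.

End CriticalExponent.

Section Comparison.
Context (R : realType) (Lambda pup pdown : R).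
Hypotheses (hLambda : 1 < Lambda) (hpup : 0 < pup) (hpdown : 0 < pdown).
Hypothesis hsum : pup + pdown = 1.
Local Notation rho := (pdown / pup).
Hypotheses (hrho : 1 < rho) (hrho2 : rho < Lambda ^+ 2).
Context (nu : probability nat R).
Context d (T : measurableType d) (P : probability T R).
Context (L : nat -> {RV P >-> nat}) (xi : nat -> {RV P >-> R}).
Hypothesis hL : markov_chain nu (walk_step pup pdown) L.
Hypothesis hxi_law : forall k : nat, has_law (xi k) (normal_prob 0 1).
Hypothesis hxi_indep : independent_seq xi.
Hypothesis hxiL_indep : independent_sigma P (sigma_rvs xi) (sigma_rvs L).
Context (b : nat -> R).
Hypothesis hb_pos : forall n, 0 < b n.

Local Notation M := (weighted_sum Lambda L xi).
Local Notation s := (critical_exponent Lambda pup pdown)^-1.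

Let rho0 : 0 < rho. Proof. exact: lt_trans hrho. Qed.
Let Lambda0 : 0 < Lambda. Proof. exact: lt_trans hLambda. Qed.
Let s0 : 0 < s. Proof. exact: critical_exponent_gt0. Qed.

Lemma initial_state_tight (eta : R) : 0 < eta ->
  exists K : nat, (P [set w | (K < L 0%N w)%N] <= eta%:E)%E.
Proof.
move=> eta0.
pose F K := [set w | (K < L 0%N w)%N].
have mF K : measurable (F K).
  exact: (@measurable_funPTI _ _ _ _ (L 0%N) [set i | (K < i)%N]).
have cF : P (F K) @[K --> \oo] --> P (\bigcap_K F K).
  apply: nonincreasing_cvg_mu => //.
  - by rewrite (le_lt_trans (probability_le1 _ _))// ltry.
  - exact: bigcap_measurable.
  - move=> m n mn; apply/subsetPset => w; exact: leq_ltn_trans.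
have F0 : \bigcap_K F K = set0.
  by apply/seteqP; split => // w /(_ (L 0%N w) I); rewrite /F/= ltnn.
move: cF; rewrite F0 measure0 => /fine_cvgP[_ /cvgr0Pnorm_le/(_ eta eta0)].
case=> K _ /(_ K (leqnn K))/=; rewrite ger0_norm ?fine_ge0//.
rewrite -lee_fin fineK ?fin_num_measure// => hK.
by exists K.
Qed.

Lemma weighted_sum_negligible :
  much_less (fun n : nat => n%:R `^ s) b ->
  cvg_in_probability P (fun n w => M n w / b n) (fun=> 0).
Proof.
move=> hb e e0.
apply: cvge0_of_eventually_le => [n|eta eta0]; first exact: measure_ge0.
have eta30 : 0 < eta / 3 by rewrite divr_gt0.
have [K hK] := initial_state_tight eta30.
have [C C0 hC] := @normal_second_moment_bounded R.
pose q := Lambda ^+ 2 / rho.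
have q1 : 1 < q by rewrite ltr_pdivlMr// mul1r.
pose c := rho ^+ K / pup.
have c_gt0 : 0 < c by rewrite divr_gt0// exprn_gt0.
pose c1 := c / (1 - rho^-1).
have c10 : 0 < c1 by rewrite divr_gt0// subr_gt0 invf_lt1.
pose c2 := c / (q - 1).
have c20 : 0 < c2 by rewrite divr_gt0// subr_gt0.
(* The height will be the first exponent at which a power of rho exceeds n B; the
choice of B makes the second term of [weighted_sum_tail] at most eta / 3. *)
pose B := Num.max 1 (c1 / (eta / 3)).
have B1 : 1 <= B by rewrite le_max lexx.
have B0 : 0 < B by exact: lt_le_trans B1.
have c1B : c1 / B <= eta / 3.
  rewrite ler_pdivrMr// mulrC -ler_pdivrMr//.
  by rewrite le_max lexx orbT.
(* The third term of [weighted_sum_tail] will be at most D (u n) ^ 2. *)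
pose D := C * c2 / e ^+ 2 * (Lambda * B `^ s) ^+ 2 / B.
pose u n := n%:R `^ s / b n.
have Du : D * (u n * u n) @[n --> \oo] --> (0 : R).
  rewrite -(mulr0 D) -[X in D * X](mulr0 0).
  by apply: cvgM; [exact: cvg_cst|exact: cvgM].
have {}Du : \forall n \near \oo, D * (u n * u n) <= eta / 3.
  move/cvgr0Pnorm_le : Du => /(_ _ eta30); apply: filterS => n.
  by apply: le_trans; exact: ler_norm.
near=> n.
have Dn : D * (u n * u n) <= eta / 3 by near: n.
have n0 : (0 < n)%N by near: n; exact: nbhs_infty_gt.
have nR0 : 0 < n%:R :> R by rewrite ltr0n.
have nR1 : 1 <= n%:R :> R by rewrite ler1n.
have bn0 := hb_pos n.
have [h /andP[hy1 hy2]] : exists h, rho ^+ h <= n%:R * B < rho ^+ h.+1.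
  by apply: exists_log_floor => //; rewrite -[leLHS]mulr1 ler_pM.
have x0 : 0 < e * b n by rewrite mulr_gt0.
rewrite (_ : [set w | _] = [set w | e * b n < `|M n w|]); last first.
  apply/seteqP; split => w /=.
    by rewrite subr0 normrM normfV (gtr0_norm bn0) ltr_pdivlMr.
  by rewrite subr0 normrM normfV (gtr0_norm bn0) ltr_pdivlMr.
(* The height is h + 1 because rho ^ (h + 1) is the first power above n B. *)
have := weighted_sum_tail hpup hpdown hsum hrho hrho2 hL hxi_law
  hxi_indep hxiL_indep K h.+1 n.-1 C0 x0 hC.
rewrite prednK// => /le_trans; apply.
rewrite [leRHS](_ : _ = (eta / 3)%:E + (eta / 3 + eta / 3)%:E)%E; last first.
  by rewrite -EFinD; congr EFin; lra.
rewrite leeD// lee_fin lerD//.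
  apply: le_trans c1B; rewrite mulrCA -/c -/c1 ler_wpM2l ?(ltW c10)//.
  rewrite ler_pdivrMr ?exprn_gt0// mulrC ler_pdivlMr//.
  exact: ltW.
apply: le_trans Dn.
have LH : Lambda ^+ h.+1 <= Lambda * (B `^ s * n%:R `^ s).
  rewrite exprS ler_wpM2l ?(ltW Lambda0)// -(powR_critical_exponent hLambda hrho).
  rewrite -powRM ?(ltW B0) ?(ltW nR0)// [B * _]mulrC.
  apply: ge0_ler_powR => //; first exact: ltW.
    by rewrite nnegrE exprn_ge0// ltW.
  by rewrite nnegrE mulr_ge0// ltW.
have qH : q ^+ h.+1 <= (Lambda * (B `^ s * n%:R `^ s)) ^+ 2 / (n%:R * B).
  rewrite /q (expr_div_n (Lambda ^+ 2)) -exprM mulnC exprM.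
  apply: ler_pM.
  - exact: sqr_ge0.
  - by rewrite invr_ge0 exprn_ge0// ltW.
  - by rewrite ler_pXn2r ?nnegrE ?(le_trans _ LH)// exprn_ge0// ltW.
  - have rH0 : 0 < rho ^+ h.+1 by rewrite exprn_gt0.
    have nB0 : 0 < n%:R * B by rewrite mulr_gt0.
    by rewrite lef_pV2 ?posrE// ltW.
rewrite -/q -/c (_ : D * (u n * u n) = C / (e * b n) ^+ 2 * (n%:R * (c *
  ((Lambda * (B `^ s * n%:R `^ s)) ^+ 2 / (n%:R * B) / (q - 1))))).
  rewrite ler_wpM2l ?divr_ge0 ?sqr_ge0// ler_wpM2l ?(ltW nR0)//.
  rewrite ler_wpM2l ?(ltW c_gt0)// ler_wpM2r// invr_ge0 subr_ge0.
  exact: ltW.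
rewrite /D /u /c2; field.
by rewrite !gt_eqF// subr_gt0.
Unshelve. all: by end_near. Qed.

Lemma weighted_sum_diverges :
  much_less b (fun n : nat => n%:R `^ s) ->
  forall r : R, 0 < r ->
  P [set w | r < `|M n w / b n|] @[n --> \oo] --> 1%E.
Proof.
move=> hb r r0.
have mM n : measurable [set w | `|M n w| <= r * b n].
  have mA : measurable_fun setT (fun w => `|M n w|).
    by apply: measurableT_comp => //; exact: measurable_weighted_sum.
  rewrite (_ : [set w | _] = (fun w => `|M n w|) @^-1` `]-oo, r * b n]%classic).
    by rewrite -[X in measurable X]setTI; exact: mA.
  by apply/seteqP; split => w/=; rewrite in_itv.
have cE n : P [set w | r < `|M n w / b n|] =
    (1 - P [set w | (`|M n w| <= r * b n)%R])%E.
  rewrite -probability_setC//; congr (P _).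
  apply/seteqP; split => w /=; rewrite normrM normfV (gtr0_norm (hb_pos n));
    rewrite ltr_pdivlMr// ltNge; by move/negP.
rewrite (_ : (fun n => _) = fun n => (1 - P [set w | (`|M n w| <= r * b n)%R])%E);
  last exact/funext.
rewrite -[X in _ --> X]sube0; apply: cvgeB => //; first exact: cvg_cst.
apply: cvge0_of_eventually_le => [n|eta eta0]; first exact: measure_ge0.
have eta20 : 0 < eta / 2 by rewrite divr_gt0.
pose c3 := (1 + (pup * (rho - 1))^-1) / (rho - 1).
have r10 : 0 < rho - 1 by rewrite subr_gt0.
have c30 : 0 < c3 by rewrite divr_gt0// addr_gt0// invr_gt0 mulr_gt0.
(* With rho ^ h at most n delta, the walk stays below h with probability at most
eta / 2. *)
pose delta := eta / 2 / c3.
have d0 : 0 < delta by rewrite divr_gt0.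
pose D := normal_peak 1 * (2 * r * Lambda / delta `^ s) : R.
have Du : D * (b n / n%:R `^ s) @[n --> \oo] --> (0 : R).
  by rewrite -(mulr0 D); apply: cvgM => //; exact: cvg_cst.
have {}Du : \forall n \near \oo, D * (b n / n%:R `^ s) <= eta / 2.
  move/cvgr0Pnorm_le : Du => /(_ _ eta20); apply: filterS => n.
  by apply: le_trans; exact: ler_norm.
near=> n.
have Dn : D * (b n / n%:R `^ s) <= eta / 2 by near: n.
have n0 : (0 < n)%N by near: n; exact: nbhs_infty_gt.
have nR0 : 0 < n%:R :> R by rewrite ltr0n.
have dn : delta^-1 <= n%:R by near: n; exact: nbhs_infty_ger.
have bn0 := hb_pos n.
have dn1 : 1 <= n%:R * delta by rewrite -ler_pdivrMr// mul1r.
have [h /andP[hy1 hy2]] := exists_log_floor hrho dn1.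
have x0 : 0 <= r * b n by rewrite mulr_ge0// ltW.
have := weighted_sum_small_ball hLambda hpup hpdown hsum hrho hL hxi_law
  hxi_indep hxiL_indep h n.-1 x0.
rewrite prednK// => /le_trans; apply.
rewrite lee_fin [leRHS](_ : _ = eta / 2 + eta / 2); last by lra.
rewrite lerD//.
  rewrite ler_pdivrMr//.
  apply: (le_trans (hitting_potential_bound hpup hrho h)).
  rewrite -/c3 mulrC -ler_pdivlMr//.
  by rewrite (le_trans hy1)// /delta mulrC mulrAC.
apply: le_trans Dn.
have ds0 : 0 < delta `^ s by rewrite powR_gt0.
have ns0 : 0 < n%:R `^ s by rewrite powR_gt0.
have LH : delta `^ s * n%:R `^ s / Lambda <= Lambda ^+ h.
  rewrite ler_pdivrMr// -exprSr -(powR_critical_exponent hLambda hrho).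
  rewrite -powRM ?(ltW d0) ?(ltW nR0)// mulrC.
  apply: ge0_ler_powR; [exact: ltW| | |exact: ltW].
    by rewrite nnegrE mulr_ge0// ltW.
  by rewrite nnegrE exprn_ge0// ltW.
rewrite /D -[leRHS]mulrA ler_wpM2l ?normal_peak_ge0//.
rewrite (_ : _ * (b n / _) = 2 * (r * b n) / (delta `^ s * n%:R `^ s / Lambda)).
  rewrite ler_wpM2l ?(mulr_ge0 _ x0)// lef_pV2 ?posrE ?exprn_gt0//.
  by rewrite divr_gt0// mulr_gt0.
by field; rewrite !gt_eqF.
Unshelve. all: by end_near. Qed.

End Comparison.

Theorem theorem2p3 (R : realType) (Lambda pup pdown : R)
    (hLambda : 1 < Lambda) (hpup : 0 < pup) (hpdown : 0 < pdown)
    (hsum : pup + pdown = 1)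
    (hratio1 : 1 < pdown / pup) (hratio2 : pdown / pup < Lambda ^+ 2)
    (nu : probability nat R)
    (d : measure_display) (T : measurableType d) (P : probability T R)
    (L : nat -> {RV P >-> nat}) (xi : nat -> {RV P >-> R})
    (hL : markov_chain nu (walk_step pup pdown) L)
    (hxi_law : forall k : nat, has_law (xi k) (normal_prob 0 1))
    (hxi_indep : independent_seq xi)
    (hxiL_indep : independent_sigma P (sigma_rvs xi) (sigma_rvs L))
    (b : nat -> R) (hb_pos : forall n : nat, 0 < b n)
    (hb_infty : b n @[n --> \oo] --> +oo) :
  let alpha := critical_exponent Lambda pup pdown in
  let M := weighted_sum Lambda L xi in
  (much_less (fun n : nat => n%:R `^ alpha^-1) b ->
     cvg_in_probability P (fun n w => M n w / b n) (fun=> 0))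
  /\
  (much_less b (fun n : nat => n%:R `^ alpha^-1) ->
     forall r : R, 0 < r ->
       limn_esup (fun n : nat => P [set w | r < `|M n w / b n|]) = 1%E).
Proof.
split=> [hb|hb r r0].
  exact: (weighted_sum_negligible hLambda hpup hpdown hsum hratio1 hratio2 hL).
have cvg1 := weighted_sum_diverges hLambda hpup hpdown hsum hratio1 hL
  hxi_law hxi_indep hxiL_indep hb_pos hb r0.
rewrite is_cvg_limn_esupE; last by apply/cvg_ex; exists 1%E.
exact/cvg_lim.
Qed.
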